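(* Let $\overline{A}=(A_1,\dots,A_X)$ and $\overline{A}'=(A'_1,\dots,A'_{X'})$ be two cardinalities with associated spaces $\mathcal{A}$ and $\mathcal{A}'$, and let $\Lambda:\mathcal{A}\to\mathcal{A}'$ be a causal (or, equivalently, completely positive) local transformation. Then $\Lambda$ is a convex mixture of deterministic local maps: there exist finitely many deterministic local maps $\Lambda^i:\mathcal{A}\to\mathcal{A}'$ and real numbers $p_i\ge 0$ with $\sum_i p_i=1$ such that $$\Lambda=\sum_i p_i\,\Lambda^i .$$
   Context: A cardinality $\overline{A}=(A_1,\dots,A_X)$ is a finite nonempty sequence of positive integers: a device has inputs $x\in\{1,\dots,X\}$ and, for input $x$, outputs $a\in\{1,\dots,A_x\}$. The associated space is $\mathcal{A}=\mathbb{R}^{d}$ with $d=\sum_x A_x$, whose coordinates are indexed by pairs $(a,x)$; the coordinate of $\vec P\in\mathcal{A}$ is written $P(a|x)$. A linear map $\Lambda:\mathcal{A}\to\mathcal{A}'$ is given by its matrix $\Lambda_{(a',x'),(a,x)}$, acting by $P'(a'|x')=\sum_{x}\sum_{a=1}^{A_x}\Lambda_{(a',x'),(a,x)}P(a|x)$. Causal local transformation: there exist conditional probability distributions $\mathrm{P}(x|x')$ and $\mathrm{P}(a'|x,a,x')$ (with $a\in\{1,\dots,A_x\}$, $a'\in\{1,\dots,A'_{x'}\}$) such that $\Lambda_{(a',x'),(a,x)}=\mathrm{P}(x|x')\,\mathrm{P}(a'|x,a,x')$ for all indices. Completely positive local transformation: for every cardinality $\overline{B}$ with space $\mathcal{B}$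 and every $\vec P\in\mathcal{A}\otimes\mathcal{B}$ with $P(ab|xy)\ge0$ for all $a,b,x,y$ and $\sum_{ab}P(ab|xy)=1$ for all $x,y$, the vector $(\Lambda\otimes\mathrm{id}_{\mathcal{B}})\vec P$ has the same two properties in $\mathcal{A}'\otimes\mathcal{B}$. These two notions coincide. Deterministic local map: determined by an input mapping $\xi:\{1,\dots,X'\}\to\{1,\dots,X\}$ and output mappings $\alpha_{x'}:\{1,\dots,A_{\xi(x')}\}\to\{1,\dots,A'_{x'}\}$ for $x'=1,\dots,X'$, with $\Lambda_{(a',x'),(a,x)}=1$ if $x=\xi(x')$ and $a'=\alpha_{x'}(a)$, and $0$ otherwise. *)

(* Defs.v *)
From mathcomp Require Import all_boot all_order all_algebra.
From mathcomp Require Import reals.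

Set Implicit Arguments.
Unset Strict Implicit.
Unset Printing Implicit Defensive.

Import Order.TTheory GRing.Theory Num.Theory.
Local Open Scope ring_scope.

Record cardinality := Cardinality {
  ninputs : nat;
  noutputs :> 'I_ninputs -> nat;
  ninputs_gt0 : (0 < ninputs)%N;
  noutputs_gt0 : forall x, (0 < noutputs x)%N }.

Definition space_dim (A : cardinality) : nat := (\sum_(x < ninputs A) A x)%N.

(* The coordinate labelled (a, x), also written (a|x).  [tagnat.Rank] is the
   enumeration, block by block, of the pairs (x, a) that underlies the block
   matrices of [matrix]; it is a bijection onto ['I_(space_dim A)]. *)
Definition coord (A : cardinality) (x : 'I_(ninputs A)) (a : 'I_(A x)) :
  'I_(space_dim A) := tagnat.Rank x a.

Lemma big_coord (V : nmodType) (A : cardinality) (F : 'I_(space_dim A) -> V) :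
  \sum_(i < space_dim A) F i = \sum_(x < ninputs A) \sum_(a < A x) F (coord a).
Proof.
rewrite (sig_big_dep xpredT (fun=> xpredT)
  (fun (x : 'I_(ninputs A)) (a : 'I_(A x)) => F (coord a))) /=.
rewrite (reindex (@tagnat.rank _ A)) /=; last exact: tagnat.rank_bij_on.
by apply: eq_bigr => s _; rewrite tagnat.rankE.
Qed.

Definition distribution (R : realType) (T : finType) (p : T -> R) : Prop :=
  (forall t, 0 <= p t) /\ \sum_t p t = 1.

(* A linear map from the space of A to that of A' is given by its matrix
   ['M_(space_dim A', space_dim A)], acting on column vectors by [*m]. *)
Definition causal (R : realType) (A A' : cardinality)
    (L : 'M[R]_(space_dim A', space_dim A)) : Prop :=
  exists (p : 'I_(ninputs A') -> 'I_(ninputs A) -> R)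
         (q : forall (x' : 'I_(ninputs A')) (x : 'I_(ninputs A)),
                'I_(A x) -> 'I_(A' x') -> R),
    [/\ forall x', distribution (p x'),
        forall x' x a, distribution (q x' x a)
      & forall x' (a' : 'I_(A' x')) x (a : 'I_(A x)),
          L (coord a') (coord a) = p x' x * q x' x a a'].

(* The tensor product of the spaces of A and B is represented by the matrices
   ['M_(space_dim A, space_dim B)], with P(ab|xy) = P (coord a) (coord b); the
   tensor product of L with the identity of the second factor then sends P to
   [L *m P], see [mulmx_coord]. *)
Definition bipartite_correlation (R : realType) (A B : cardinality)
    (P : 'M[R]_(space_dim A, space_dim B)) : Prop :=
  (forall x (a : 'I_(A x)) y (b : 'I_(B y)), 0 <= P (coord a) (coord b)) /\
  (forall (x : 'I_(ninputs A)) (y : 'I_(ninputs B)),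
     \sum_(a < A x) \sum_(b < B y) P (coord a) (coord b) = 1).

Lemma mulmx_coord (R : realType) (A A' B : cardinality)
    (L : 'M[R]_(space_dim A', space_dim A)) (P : 'M[R]_(space_dim A, space_dim B))
    x' (a' : 'I_(A' x')) y (b : 'I_(B y)) :
  (L *m P) (coord a') (coord b) =
  \sum_(x < ninputs A) \sum_(a < A x)
    L (coord a') (coord a) * P (coord a) (coord b).
Proof. by rewrite mxE big_coord. Qed.

Definition completely_positive (R : realType) (A A' : cardinality)
    (L : 'M[R]_(space_dim A', space_dim A)) : Prop :=
  forall (B : cardinality) (P : 'M[R]_(space_dim A, space_dim B)),
    bipartite_correlation P -> bipartite_correlation (L *m P).

(* The two clauses give all entries of L: those with x = xi x' and those with
   x != xi x'; splitting avoids a transport of a along x = xi x'. *)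
Definition deterministic_local (R : realType) (A A' : cardinality)
    (L : 'M[R]_(space_dim A', space_dim A)) : Prop :=
  exists (xi : 'I_(ninputs A') -> 'I_(ninputs A))
         (alpha : forall x', 'I_(A (xi x')) -> 'I_(A' x')),
    (forall x' (a' : 'I_(A' x')) (a : 'I_(A (xi x'))),
       L (coord a') (coord a) = (a' == alpha x' a)%:R) /\
    (forall x' (a' : 'I_(A' x')) x (a : 'I_(A x)),
       x != xi x' -> L (coord a') (coord a) = 0).

(* Main.v *)
(** Let [L] be completely positive.  Testing it on correlations with a one-input,
    two-output second party, in which both outputs are functions of [x], shows
    that the entries of [L] are nonnegative and that in each block [(x', x)] all
    columns have the same sum; this common sum is [P(x|x')], so [L] is causal.
    A causal map is the mixture over independent choices, one per [x'], of an
    input [x] (with weight [P(x|x')]) and of a function [g] (with weight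
    [\prod_a P(g a|x,a,x')]); marginalising these product weights gives back
    [P(x|x') P(a'|x,a,x')]. *)

Require Import Defs.
From mathcomp Require Import all_boot all_order all_algebra.
From mathcomp Require Import reals.

Set Implicit Arguments.
Unset Strict Implicit.
Unset Printing Implicit Defensive.

Import Order.TTheory GRing.Theory Num.Theory.
Local Open Scope ring_scope.

(* [all_algebra] also exports a [coord], that of [vector]. *)
Local Notation coord := Defs.coord.

(** Distributivity for dependent families: tagging the values gives all factors one index type,
    where the non-dependent law applies; [big_fprod] then returns to [fprod T]. *)
Lemma prod_sum_fprod (R : comPzSemiRingType) (I : finType) (T : I -> finType)
    (F : forall i, T i -> R) :
  \prod_i \sum_(t : T i) F i t = \sum_(f : fprod T) \prod_i F i (f i).
Proof.
pose P i := [ffun t => F i t].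
transitivity (\prod_i \sum_(s in tagged_with T i) untag 0 (P i) s).
  apply: eq_bigr => i _; rewrite -(big_tag (fun i t => P i t)).
  by apply: eq_bigr => t _; rewrite ffunE.
rewrite bigA_distr_big_dep -(big_fprod _ _ P).
by apply: eq_bigr => f _; apply: eq_bigr => i _; rewrite ffunE.
Qed.

(** Under product weights, every coordinate other than [j] sums out to 1. *)
Lemma sum_fprod_marginal (R : comPzRingType) (V : lmodType R) (I : finType)
    (T : I -> finType) (w : forall i, T i -> R) (j : I) (h : T j -> V) :
  (forall i, \sum_t w i t = 1) ->
  \sum_(f : fprod T) (\prod_i w i (f i)) *: h (f j) = \sum_t w j t *: h t.
Proof.
move=> w1.
rewrite (partition_big (fun f : fprod T => f j) predT) //=.
apply: eq_bigr => u _.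
under eq_bigr => f /eqP -> do [].
rewrite -scaler_suml; congr (_ *: _).
(* The constraint [f j = u] becomes a factor of the product, so that distributivity applies. Tagging
   lets [t : T i] be compared with [u : T j]. *)
pose F i (t : T i) := w i t * (if i == j then (Tagged T t == Tagged T u)%:R else 1).
transitivity (\sum_(f : fprod T) \prod_i F i (f i)).
  rewrite big_mkcond; apply: eq_bigr => f _; rewrite big_split /=.
  by rewrite -big_mkcond big_pred1_eq eq_Tagged /=; case: eqP; rewrite ?mulr1 ?mulr0.
rewrite -prod_sum_fprod (bigD1 j) //= [X in _ * X]big1 ?mulr1; last first.
  move=> i /negPf ij.
  by rewrite /F ij -[RHS](w1 i); apply: eq_bigr => t _; rewrite mulr1.
rewrite (bigD1 u) //= /F !eqxx mulr1 big1 ?addr0 // => t /negPf tu.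
by rewrite eq_Tagged /= tu mulr0.
Qed.

Lemma eq_coord (A : cardinality) x y (a : 'I_(A x)) (b : 'I_(A y)) :
  (coord a == coord b) = (x == y) && (a == b :> nat).
Proof. exact: tagnat.eq_Rank. Qed.

Lemma coord_inj (A : cardinality) x : injective (@coord A x).
Proof. by move=> a b /eqP; rewrite eq_coord eqxx => /eqP/val_inj. Qed.

(** Written as a sum over [x'] so that each summand depends only on the choice made at [x'];
    mixtures can then be marginalised term by term. *)
Definition deterministic_mx (R : realType) (A A' : cardinality)
    (xi : 'I_(ninputs A') -> 'I_(ninputs A))
    (alpha : forall x', 'I_(A (xi x')) -> 'I_(A' x')) :
    'M[R]_(space_dim A', space_dim A) :=
  \sum_x' \sum_(b < A (xi x')) delta_mx (coord (alpha x' b)) (coord b).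

Lemma deterministic_mxP (R : realType) (A A' : cardinality)
    (xi : 'I_(ninputs A') -> 'I_(ninputs A))
    (alpha : forall x', 'I_(A (xi x')) -> 'I_(A' x')) :
  deterministic_local (deterministic_mx R alpha).
Proof.
exists xi, alpha.
have E x' (a' : 'I_(A' x')) x (a : 'I_(A x)) :
    deterministic_mx R alpha (coord a') (coord a) =
    \sum_(b < A (xi x')) ((coord a' == coord (alpha x' b)) && (coord a == coord b))%:R.
  rewrite /deterministic_mx summxE (bigD1 x') //= summxE [X in _ + X]big1 ?addr0.
    by apply: eq_bigr => b _; rewrite mxE.
  move=> y' /negPf y'x'; rewrite summxE big1 // => b _.
  by rewrite mxE eq_coord eq_sym y'x'.
split=> [x' a' a|x' a' x a /negPf xx']; rewrite E.
  rewrite (bigD1 a) //= eqxx andbT (inj_eq (@coord_inj _ _)) big1 ?addr0 // => b.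
  by rewrite eq_sym [coord a == _](inj_eq (@coord_inj _ _)) => /negPf ->; rewrite andbF.
by rewrite big1 // => b _; rewrite [coord a == _]eq_coord xx' andbF.
Qed.

Lemma mx_sum_coord_delta (R : realType) (A A' : cardinality)
    (L : 'M[R]_(space_dim A', space_dim A)) :
  L = \sum_x' \sum_x \sum_(a < A x) \sum_(a' < A' x')
        L (coord a') (coord a) *: delta_mx (coord a') (coord a).
Proof.
rewrite {1}[L]matrix_sum_delta big_coord; apply: eq_bigr => x' _.
rewrite exchange_big big_coord /=; apply: eq_bigr => x _; exact: eq_bigr.
Qed.

Lemma causal_mixture (R : realType) (A A' : cardinality)
    (L : 'M[R]_(space_dim A', space_dim A)) :
  causal L ->
  exists (T : finType) (w : T -> R) (D : T -> 'M[R]_(space_dim A', space_dim A)),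
    [/\ forall t, deterministic_local (D t), distribution w
      & L = \sum_t w t *: D t].
Proof.
move=> [p [q [p_dist q_dist LE]]].
pose G x' x : finType := fprod (fun _ : 'I_(A x) => 'I_(A' x')).
pose S x' : finType := {x : 'I_(ninputs A) & G x' x}.
pose wG x' x (g : G x' x) := \prod_a q x' x a (g a).
pose wS x' (s : S x') := p x' (tag s) * wG x' (tag s) (tagged s).
(* Averaging over the choice at [x'] means averaging over the input first, then over the
   function. *)
have sumS (V : lmodType R) x' (h : forall x, G x' x -> V) :
    \sum_(s : S x') wS x' s *: h (tag s) (tagged s) =
    \sum_x p x' x *: \sum_(g : G x' x) wG x' x g *: h x g.
  under [RHS]eq_bigr do rewrite scaler_sumr.
  by rewrite sig_big_dep /=; apply: eq_bigr => s _; rewrite scalerA.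
have wG1 x' x : \sum_(g : G x' x) wG x' x g = 1.
  rewrite -(prod_sum_fprod (fun a a' => q x' x a a')).
  by apply: big1 => a _; case: (q_dist x' x a).
have wS1 x' : \sum_(s : S x') wS x' s = 1.
  rewrite -(proj2 (p_dist x')) /wS.
  rewrite -(sig_big_dep predT (fun=> predT) (fun x g => p x' x * wG x' x g)) /=.
  by apply: eq_bigr => x _; rewrite -mulr_sumr wG1 mulr1.
pose alpha (f : fprod S) x' (b : 'I_(A (tag (f x')))) := tagged (f x') b.
exists (fprod S), (fun f : fprod S => \prod_x' wS x' (f x')),
  (fun f : fprod S => deterministic_mx R (@alpha f)); split.
- by move=> f; apply: deterministic_mxP.
- split=> [f|]; last by rewrite -prod_sum_fprod big1.
  apply: prodr_ge0 => x' _; apply: mulr_ge0; first by case: (p_dist x').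
  by apply: prodr_ge0 => a _; case: (q_dist x' (tag (f x')) a).
(* For fixed [x'], three reductions follow: from [f] to its value at [x'], from that value to a pair
   [(x, g)], and, for each [a], from [g] to [g a]. *)
rewrite {1}[L]mx_sum_coord_delta.
under [RHS]eq_bigr do rewrite scaler_sumr.
rewrite [RHS]exchange_big; apply: eq_bigr => x' _ /=.
rewrite (sum_fprod_marginal (fun s : S x' =>
  \sum_(b < A (tag s)) delta_mx (coord (tagged s b)) (coord b)) wS1).
rewrite (sumS _ x' (fun x g => \sum_b delta_mx (coord (g b)) (coord b))).
apply: eq_bigr => x _.
under [in RHS]eq_bigr do rewrite scaler_sumr.
rewrite [in RHS]exchange_big scaler_sumr; apply: eq_bigr => a _ /=.
rewrite (@sum_fprod_marginal _ _ _ _ (q x' x) a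
  (fun a' => delta_mx (coord a') (coord a))) => [|c]; last by case: (q_dist x' x c).
by rewrite scaler_sumr; apply: eq_bigr => a' _; rewrite LE scalerA.
Qed.

Lemma completely_positive_causal (R : realType) (A A' : cardinality)
    (L : 'M[R]_(space_dim A', space_dim A)) :
  completely_positive L -> causal L.
Proof.
move=> cpL.
pose B := @Cardinality 1 (fun=> 2) isT (fun=> isT).
(* The deterministic correlation a = f(x), b = g(x). It may signal from the first party to the
   second, since only positivity and normalisation are required. *)
pose P (f : forall x, 'I_(A x)) (g : 'I_(ninputs A) -> 'I_2) :
    'M[R]_(space_dim A, space_dim B) :=
  \sum_x delta_mx (coord (f x)) (@coord B ord0 (g x)).
have PE f g x (a : 'I_(A x)) (b : 'I_2) :
    P f g (coord a) (@coord B ord0 b) = ((a == f x) && (b == g x))%:R.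
  rewrite summxE (bigD1 x) //= mxE !(inj_eq (@coord_inj _ _)) big1 ?addr0 //.
  by move=> y /negPf yx; rewrite mxE eq_coord eq_sym yx.
have sumP f g x (F : 'I_(A x) -> R) b :
    \sum_a F a * P f g (coord a) (@coord B ord0 b) = F (f x) * (b == g x)%:R.
  rewrite (bigD1 (f x)) //= PE eqxx big1 ?addr0 // => a /negPf fa.
  by rewrite PE fa mulr0.
have P_corr f g : bipartite_correlation (P f g).
  split=> [x a y b|x y]; rewrite [y]ord1; first by rewrite PE ler0n.
  under eq_bigr do under eq_bigr do rewrite -[P _ _ _ _]mul1r.
  rewrite exchange_big /=; under eq_bigr do rewrite (sumP f g x (fun=> 1)) mul1r.
  by rewrite (bigD1 (g x)) //= eqxx big1 ?addr0 // => b /negPf ->.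
have LPE f g x' (a' : 'I_(A' x')) b :
    (L *m P f g) (coord a') (@coord B ord0 b) =
    \sum_x L (coord a') (coord (f x)) * (b == g x)%:R.
  rewrite mulmx_coord; apply: eq_bigr => x _.
  by rewrite (sumP f g x (fun a => L (coord a') (coord a))).
pose a0 x : 'I_(A x) := Ordinal (noutputs_gt0 x).
(* [f] with its value at [x] replaced by [a]. *)
pose set_at (f : forall x, 'I_(A x)) x (a : 'I_(A x)) y : 'I_(A y) :=
  if x =P y is ReflectT e then ecast z 'I_(A z) e a else f y.
have set_atE f x a : set_at f x a x = a.
  by rewrite /set_at; case: eqP => // e; rewrite eq_axiomK.
have set_atN f x a y : x != y -> set_at f x a y = f y.
  by rewrite /set_at; case: eqP.
have L_ge0 x' (a' : 'I_(A' x')) x (a : 'I_(A x)) : 0 <= L (coord a') (coord a).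
  (* The second output flags the input [x], so the entry at [ord0] retains only the term of [L] at
     [a]. *)
  pose g y : 'I_2 := if y == x then ord0 else ord_max.
  case: (cpL B _ (P_corr (set_at a0 x a) g)) => /(_ x' a' ord0 ord0) + _.
  rewrite LPE (bigD1 x) //= set_atE /g eqxx mulr1 big1 ?addr0 // => y /negPf ->.
  by rewrite mulr0.
pose s x' x (a : 'I_(A x)) := \sum_a' L (@coord A' x' a') (coord a).
have sum_s x' f : \sum_x s x' x (f x) = 1.
  case: (cpL B _ (P_corr f (fun=> ord0))) => _ /(_ x' ord0) <-.
  rewrite exchange_big; apply: eq_bigr => a' _ /=.
  rewrite big_ord_recl big_ord1 !LPE /=.
  rewrite [X in _ + X]big1 ?addr0 => [|x _]; last by rewrite mulr0.
  by apply: eq_bigr => x _; rewrite mulr1.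
(* The families [a0] and [set_at a0 x a] both give total 1 and differ only at [x]. *)
have s_const x' x (a : 'I_(A x)) : s x' x a = s x' x (a0 x).
  have := sum_s x' (set_at a0 x a); rewrite -[RHS](sum_s x' a0).
  rewrite (bigD1 x) //= [RHS](bigD1 x) //= set_atE.
  rewrite (eq_bigr (fun y => s x' y (a0 y))) => [/addIr //|y yx].
  by rewrite set_atN // eq_sym.
pose p x' x := s x' x (a0 x).
pose b0 x' : 'I_(A' x') := Ordinal (noutputs_gt0 x').
(* Where the weight of [x] vanishes, normalising the column is impossible and an arbitrary point
   mass serves. *)
exists p, (fun x' x a a' => if p x' x == 0 then (a' == b0 x')%:R
                            else L (coord a') (coord a) / p x' x).
have p_ge0 x' x : 0 <= p x' x by apply: sumr_ge0.
split=> [x'|x' x a|x' a' x a]; first by split; [exact: p_ge0|exact: sum_s].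
  case: eqP => [_|/eqP p0]; split=> [a'|].
  - exact: ler0n.
  - by rewrite (bigD1 (b0 x')) //= big1 ?addr0 // => a' /negPf ->.
  - by rewrite divr_ge0.
  - by rewrite -mulr_suml -[\sum_a' _]/(s x' x a) s_const divff.
case: eqP => [p0|/eqP p0]; last by rewrite mulrC divfK.
(* With zero weight, column [a] has nonnegative entries of sum 0, so they all vanish. *)
rewrite p0 mul0r; move/eqP: p0.
rewrite /p -(s_const _ _ a) psumr_eq0 // => /allP /(_ a').
by rewrite mem_index_enum => /(_ isT) /eqP.
Qed.

Theorem proposition2 (R : realType) (A A' : cardinality)
    (L : 'M[R]_(space_dim A', space_dim A)) :
  causal L \/ completely_positive L ->
  exists (n : nat) (p : 'I_n -> R) (D : 'I_n -> 'M[R]_(space_dim A', space_dim A)),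
    [/\ forall i, deterministic_local (D i),
        forall i, 0 <= p i,
        \sum_(i < n) p i = 1
      & L = \sum_(i < n) p i *: D i].
Proof.
move=> L_local; have /causal_mixture[T [w [D [D_det [w_ge0 w1] LE]]]] : causal L.
  by case: L_local => // /completely_positive_causal.
exists #|T|, (fun i => w (enum_val i)), (fun i => D (enum_val i)); split=> [i|i||].
- exact: D_det.
- exact: w_ge0.
- by rewrite -(big_enum_val w) -[RHS]w1; apply: eq_bigl.
- rewrite -(big_enum_val (fun t => w t *: D t)) LE; exact: eq_bigl.
Qed.
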